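(* Let $(G,+)$ be a finite abelian group with $|G| = \omega(n^2)$. Any non-adaptive cell probe data structure solving 3SUM-Indexing for input sets of size $n$ over $G$, using $S$ memory cells (words) of $w = \Omega(\log n)$ bits each, must have query time $T = \Omega(\min\{\log |G| / \log(Sw/n),\ n/w\})$.
   Context: 3SUM-Indexing over a finite abelian group $(G,+)$: preprocess two sets $A_1, A_2 \subseteq G$, each of size $n$, into a data structure consisting of $S$ memory cells of $w$ bits each, so that given any query element $z \in G$ one can decide whether there exist $a_1 \in A_1$, $a_2 \in A_2$ with $a_1 + a_2 = z$. In the cell probe model, the only cost of a query is the number of memory cells accessed (probed); the query time $T$ is the maximum number of cells probed on any query. A data structure is non-adaptive if the set of cells probed on query $z$ is a function of $z$ alone (not of the contents of previously probed cells). The bounds are asymptotic in $n$. *)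

(* Defs.v *)
From mathcomp Require Import all_boot all_order all_algebra.

Set Implicit Arguments.
Unset Strict Implicit.
Unset Printing Implicit Defensive.

Import GRing.Theory.

Definition word (w : nat) := w.-tuple bool.

Definition memory (S w : nat) := {ffun 'I_S -> word w}.

(* A cell probe query algorithm: computation is free, so an algorithm is a
   decision tree branching on the full content of the probed cell. *)
Inductive probe_tree (S w : nat) : Type :=
| Answer of bool
| Probe of 'I_S & (word w -> probe_tree S w).

Fixpoint run S w (t : probe_tree S w) (M : memory S w) : bool :=
  match t with
  | Answer b => b
  | Probe i k => run (k (M i)) M
  end.

Fixpoint probed S w (t : probe_tree S w) (M : memory S w) : {set 'I_S} :=
  match t with
  | Answer _ => set0
  | Probe i k => i |: probed (k (M i)) M
  end.

Record cell_probe_ds (G : finZmodType) (S w : nat) := CellProbeDS {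
  preprocess : {set G} -> {set G} -> memory S w;
  query : G -> probe_tree S w
}.

Section ThreeSumIndexing.
Variables (G : finZmodType) (S w : nat).

Definition in_sumset (A1 A2 : {set G}) (z : G) : bool :=
  [exists a1 in A1, exists a2 in A2, (a1 + a2)%R == z].

Definition solves_3SUM_indexing (n : nat) (D : cell_probe_ds G S w) : Prop :=
  forall A1 A2 : {set G}, #|A1| = n -> #|A2| = n ->
  forall z, run (query D z) (preprocess D A1 A2) = in_sumset A1 A2 z.

Definition cells_probed (D : cell_probe_ds G S w) (A1 A2 : {set G})
    (z : G) : {set 'I_S} :=
  probed (query D z) (preprocess D A1 A2).

(* Only memories that encode admissible inputs are constrained. *)
Definition nonadaptive (n : nat) (D : cell_probe_ds G S w) : Prop :=
  exists P : G -> {set 'I_S},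
  forall A1 A2 : {set G}, #|A1| = n -> #|A2| = n ->
  forall z, cells_probed D A1 A2 z = P z.

Definition query_time (n : nat) (D : cell_probe_ds G S w) : nat :=
  \max_(A1 : {set G} | #|A1| == n) \max_(A2 : {set G} | #|A2| == n)
    \max_(z : G) #|cells_probed D A1 A2 z|.

End ThreeSumIndexing.

(* Main.v *)
Require Import Defs.
From mathcomp Require Import all_boot all_order all_algebra.
From mathcomp Require Import ring lra zify.
Import Order.TTheory GRing.Theory Num.Theory.

(** A set C of cells with |C| w < n can resolve at most |C| w queries: for any
    small set Q of queries there are inputs whose sumset meets Q in an
    arbitrary prescribed subset, and |C| w bits do not suffice to record it.
    Averaging over the sets C of about n / w cells, a query falls inside a
    random C with probability about (|C| / S) ^ T, which yields
    |G| (|C| / S) ^ T <= n, up to constants. The ratio is kept in the form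
    1 + d / q with d = S - |C|, so that the bound stays sharp when S w is
    close to n. *)

Lemma run_eq_on_probed (S w : nat) (t : probe_tree S w) (M M' : memory S w) :
  (forall i, i \in probed t M -> M i = M' i) -> run t M = run t M'.
Proof.
elim: t => [b|i k IH] //= eqM.
rewrite -(eqM i) ?setU11 //; apply: IH => j jk.
by apply: eqM; rewrite inE jk orbT.
Qed.

(** * Sumsets that cut out arbitrary subsets of a small query set *)

Lemma exists_subset_card (T : finType) (A : {set T}) (k : nat) :
  k <= #|A| -> exists2 B : {set T}, B \subset A & #|B| = k.
Proof.
rewrite -bin_gt0 -cards_draws => /card_gt0P[B].
by rewrite inE => /andP[sBA /eqP kB]; exists B.
Qed.

Lemma exists_set_avoiding (T : finType) (A : {set T}) (m k : nat) :
  #|A| <= m -> m + k <= #|T| -> exists2 B : {set T}, B \subset ~: A & #|B| = k.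
Proof.
by move=> Am mk; apply: exists_subset_card; have := cardsC A; lia.
Qed.

(* The second set is 0 together with elements outside Q - Q, so it creates
   no accidental sum inside Q; Y is completed to n elements outside Q - A2. *)
Lemma sumset_shatters (G : finZmodType) (n : nat) (Q : {set G}) :
  0 < n -> n ^ 2 + n <= #|G| -> #|Q| <= n ->
  exists2 A2 : {set G}, #|A2| = n &
  forall Y : {set G}, Y \subset Q ->
  exists2 A1 : {set G}, #|A1| = n &
  forall z, z \in Q -> in_sumset A1 A2 z = (z \in Y).
Proof.
move=> n0 nG nQ.
pose sub (A B : {set G}) : {set G} := [set (a - b)%R | a in A, b in B].
have card_sub (A B : {set G}) : #|A| <= n -> #|B| <= n -> #|sub A B| <= n ^ 2.
  move=> An Bn; rewrite /sub curry_imset2X.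
  by rewrite (leq_trans (leq_imset_card _ _)) // cardsX -mulnn leq_mul.
(* At most [n ^ 2 + 1] elements are forbidden, so [n ^ 2 + n <= #|G|] leaves exactly the room needed
   for [n - 1] others. The count for [D] below is similar. *)
have [||B sB cB] := @exists_set_avoiding _ (0%R |: sub Q Q) (n ^ 2).+1 n.-1.
- by rewrite cardsU1 -add1n leq_add ?leq_b1 ?card_sub.
- by move: nG; rewrite addSnnS prednK.
have B0 : 0%R \notin B.
  by apply/negP => /(subsetP sB); rewrite !inE eqxx.
pose A2 := 0%R |: B.
have cA2 : #|A2| = n by rewrite cardsU1 B0 cB; lia.
exists A2 => // Y sYQ.
have cY := subset_leq_card sYQ.
have [||D sD cD] :=
    @exists_set_avoiding _ (Y :|: sub Q A2) (#|Y| + n ^ 2) (n - #|Y|).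
- have [cYU _] := leq_card_setU Y (sub Q A2).
  by rewrite (leq_trans cYU) // leq_add2l card_sub // cA2.
- by move: nG; rewrite addnAC subnKC ?(leq_trans cY) // addnC.
have dYD : [disjoint Y & D].
  rewrite disjoint_sym disjoints_subset (subset_trans sD) // setCS.
  exact: subsetUl.
exists (Y :|: D).
  by have [_] := leq_card_setU Y D; rewrite dYD => /eqP ->; rewrite cD; lia.
move=> z zQ; apply/idP/idP; last first.
  move=> zY; apply/existsP; exists z; rewrite inE zY /=.
  by apply/existsP; exists 0%R; rewrite !inE eqxx /= addr0.
case/existsP=> a1 /andP[a1A] /existsP[a2 /andP[a2A /eqP Ez]].
move: a1A; rewrite inE => /orP[a1Y|/(subsetP sD)]; last first.
  rewrite !inE negb_or => /andP[_] /imset2P[]; exists z a2 => //.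
  by rewrite -Ez addrK.
move: a2A; rewrite !inE => /orP[/eqP a20|/(subsetP sB)].
  by rewrite -Ez a20 addr0.
rewrite !inE negb_or => /andP[_] /imset2P[]; exists z a1 => //.
  exact: (subsetP sYQ).
by rewrite -Ez addrC addKr.
Qed.

(** * Ratios of binomial coefficients *)

(** The quotient of the two binomials is the product of (q + d + i) / (q + i) for i from 1 to T, and
    each factor is at most (q + d) / q. Cross-multiplying avoids division. *)
Lemma bin_ratio_le (q d T : nat) :
  'C(q + d + T, d) * q ^ T <= 'C(q + d, d) * (q + d) ^ T.
Proof.
elim: T => [|T IH]; first by rewrite addn0.
have := mul_bin_down (q + d + T).+1 d; rewrite /= -addnS => E.
rewrite -(@leq_pmul2l (q + T).+1) //.
have -> : (q + T).+1 * ('C(q + d + T.+1, d) * q ^ T.+1) =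
  (q + d + T.+1) * q * ('C(q + d + T, d) * q ^ T).
  rewrite expnS [LHS](_ : _ = ((q + d + T.+1) - d) * 'C(q + d + T.+1, d) * (q * q ^ T)).
    by rewrite -E; ring.
  by rewrite (_ : q + d + T.+1 - d = (q + T).+1); [ring|lia].
have -> : (q + T).+1 * ('C(q + d, d) * (q + d) ^ T.+1) =
  (q + T).+1 * (q + d) * ('C(q + d, d) * (q + d) ^ T) by rewrite expnS; ring.
by apply: leq_mul => //; nia.
Qed.

(** * Counting resolved queries for a fixed input size *)

Section Resolved.
Variables (G : finZmodType) (S w n : nat) (D : cell_probe_ds G S w).
Variable P : G -> {set 'I_S}.
Hypothesis solvesD : solves_3SUM_indexing n D.
Hypothesis probesD : forall A1 A2 : {set G}, #|A1| = n -> #|A2| = n ->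
  forall z, cells_probed D A1 A2 z = P z.
Hypotheses (n_gt0 : 0 < n) (large_G : n ^ 2 + n <= #|G|).

(* Otherwise more than #|C| * w queries determined by C could be given
   arbitrary answers, each pattern requiring its own contents of C. *)
Lemma card_resolved (C : {set 'I_S}) :
  #|C| * w < n -> #|[set z | P z \subset C]| <= #|C| * w.
Proof.
(* [Q] gets [#|C| * w + 1] elements: one more than the number of bits in [C], yet still at most
   [n]. *)
move=> Cn; rewrite leqNgt; apply/negP => /exists_subset_card[Q sQ cQ].
have [|A2 cA2 shat] := @sumset_shatters G n Q n_gt0 large_G; first by lia.
have /fin_all_exists2[A1 cA1 ansA1] (Y : {set G}) : exists2 A1 : {set G},
    #|A1| = n & Y \subset Q -> {in Q, forall z, in_sumset A1 A2 z = (z \in Y)}.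
  have [/shat[A1 ? ?]|_] := boolP (Y \subset Q); first by exists A1.
  (* A dummy of the right size for [Y] outside the powerset of [Q], which makes the choice of [A1]
     total. *)
  by exists A2.
pose M Y := preprocess D (A1 Y) A2.
pose o : word w := [tuple false | _ < w].
(* Blanking the cells outside [C] keeps all answers on [Q] and leaves at most [2 ^ (#|C| * w)]
   memories. *)
pose F Y : memory S w := [ffun i => if i \in C then M Y i else o].
have Finj : {in powerset Q &, injective F}.
  move=> Y Z; rewrite !powersetE => sY sZ eqF; apply/setP => z.
  have [zQ|zQ] := boolP (z \in Q); last first.
    by rewrite !(contraNF (subsetP _ z) zQ).
  rewrite -(ansA1 _ sY _ zQ) -(ansA1 _ sZ _ zQ) -!solvesD //.
  apply: run_eq_on_probed => i; rewrite -/(cells_probed D (A1 Y) A2 z) probesD //.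
  have /(subsetP sQ) := zQ; rewrite inE => /subsetP PC /PC iC.
  by move/ffunP: eqF => /(_ i); rewrite !ffunE iC.
have : #|F @: powerset Q| <= #|pffun_on o (mem C) (mem [set: word w])|.
  apply/subset_leq_card/subsetP => f /imsetP[Y _ ->].
  apply/pffun_onP; split=> [|y _]; last by rewrite inE.
  by apply/supportP => i iC; rewrite ffunE (negPf iC).
rewrite card_in_imset // card_powerset cQ card_pffun_on.
by rewrite cardsT card_tuple card_bool -expnM leq_exp2l // mulnC ltnn.
Qed.

(** The maximum ranges over admissible inputs, so one must exist: this is where [n <= #|G|]
    enters. *)
Lemma card_probed_le_query_time z : #|P z| <= query_time n D.
Proof.
have [|A _ cA] := @exists_subset_card G [set: G] n.
  by rewrite cardsT (leq_trans _ large_G) ?leq_addl.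
rewrite -(probesD _ _ cA cA) /query_time.
apply: leq_trans (leq_bigmax_cond A _); last exact/eqP.
apply: leq_trans (leq_bigmax_cond A _); last exact/eqP.
exact: (leq_bigmax z).
Qed.

(** Otherwise [C] could consist of all cells, which resolve every query, forcing [#|G| < n]. It
    ensures that the logarithm of Sw/n is nonnegative. *)
Lemma memory_size_ge : n <= S * w.
Proof.
rewrite leqNgt; apply/negP => Sn.
have := @card_resolved setT; rewrite cardsT card_ord => /(_ Sn).
rewrite (_ : [set z | _] = setT) ?cardsT; last first.
  by apply/setP => z; rewrite !inE subsetT.
by rewrite leqNgt (leq_trans Sn) ?(leq_trans _ large_G) ?leq_addl.
Qed.

(* Double counting of pairs (z, E), where E is a set of d cells avoiding P z. *)
Lemma cell_sampling d : d <= S -> (S - d) * w < n ->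
  #|G| * 'C(S - query_time n D, d) <= n * 'C(S, d).
Proof.
move=> dS dn; pose draws := [set E : {set 'I_S} | #|E| == d].
have card_drawsE : #|draws| = 'C(S, d) by rewrite card_draws card_ord.
have -> : n * 'C(S, d) = \sum_(E in draws) n.
  by rewrite sum_nat_const card_drawsE mulnC.
have -> : #|G| * 'C(S - query_time n D, d) =
          \sum_(z : G) 'C(S - query_time n D, d) by rewrite sum_nat_const.
apply: (@leq_trans (\sum_(E in draws) \sum_(z : G | P z \subset ~: E) 1)).
  rewrite (exchange_big_dep predT) //=; apply: leq_sum => z _.
  rewrite sum1dep_card; apply: (@leq_trans 'C(#|~: P z|, d)).
    have := cardsC (P z); rewrite card_ord => cP.
    by apply: leq_bin2l; have := card_probed_le_query_time z; lia.
  rewrite -cards_draws; apply/eq_leq/eq_card => E; rewrite !inE.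
  by rewrite subsetC andbC.
apply: leq_sum => E; rewrite inE => /eqP cE.
have cEC : #|~: E| = S - d by have := cardsC E; rewrite card_ord cE; lia.
rewrite sum1dep_card; apply: leq_trans (card_resolved _ _) _; rewrite cEC //.
exact: ltnW.
Qed.

(** Sampling keeps [q + T] cells and drops [d], so that [S - T = q + d] and [bin_ratio_le] bounds
    the binomials of [cell_sampling]. *)
Lemma query_time_tradeoff q d :
  q + d + query_time n D = S -> (q + query_time n D) * w < n ->
  #|G| * q ^ query_time n D <= n * (q + d) ^ query_time n D.
Proof.
set T := query_time n D => eS qn.
have := @cell_sampling d; rewrite -/T -[in 'C(_, d)]eS -[in 'C(S, d)]eS addnK.
rewrite (_ : S - d = q + T); last by lia.
have dS : d <= S by lia.
move=> /(_ dS qn).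
have := bin_ratio_le q d T; have : 0 < 'C(q + d, d) by rewrite bin_gt0; lia.
move: 'C(q + d, d) 'C(q + d + T, d) => c c' c0 le_c' le_c.
rewrite -(leq_pmul2l c0) mulnCA mulnA (leq_trans (leq_mul le_c (leqnn _))) //.
by rewrite -mulnA (mulnCA c) leq_mul2l le_c' orbT.
Qed.

End Resolved.


(* From the counting inequality to the asymptotic bound *)
From mathcomp Require Import all_classical all_reals all_analysis.
Import numFieldNormedType.Exports.
Local Open Scope classical_set_scope.
Local Open Scope ring_scope.

Lemma bernoulli_inequality (R : realDomainType) (x : R) (k : nat) :
  0 <= x -> 1 + k%:R * x <= (1 + x) ^+ k.
Proof.
move=> x0; elim: k => [|k IH]; first by rewrite mul0r addr0 expr0.
have kx0 : 0 <= k%:R * x by rewrite mulr_ge0.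
by rewrite exprS -natr1; nra.
Qed.

Lemma min_le_query_time (R : realType) (g n S w T : nat) :
  (1 < n)%N -> (n ^ 2 + n <= g)%N -> (n <= S * w)%N ->
  (forall q d, q + d + T = S -> (q + T) * w < n ->
     g * q ^ T <= n * (q + d) ^ T)%N ->
  `|Num.min (ln g%:R / ln (S%:R * w%:R / n%:R)) (n%:R / w%:R)| <= 16%:R * T%:R :> R.
Proof.
move=> n1 gn nS tradeoff.
have w0 : (0 < w)%N by case: (posnP w) nS => // ->; rewrite muln0; lia.
have nR : 0 < n%:R :> R by rewrite ltr0n; lia.
have wR : 0 < w%:R :> R by rewrite ltr0n.
have gR : 4 <= g%:R :> R by rewrite ler_nat; nia.
set x : R := S%:R * w%:R / n%:R.
have x1 : 1 <= x by rewrite ler_pdivlMr // mul1r -natrM ler_nat.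
have lnx0 := ln_ge0 x1.
(* From ln (1/g) <= 1/g - 1. This 3/4 turns the factor 12 = 2 * 6 obtained below into 16. *)
have lng : 3 / 4 <= ln g%:R :> R.
  have gV : (g%:R : R)^-1 <= 4^-1 by rewrite lef_pV2 ?posrE; lra.
  have gV0 : 0 < (g%:R : R)^-1 by rewrite invr_gt0; lra.
  have : ln (1 + (g%:R^-1 - 1)) <= g%:R^-1 - 1 :> R by apply: le_ln1Dx; lra.
  by rewrite addrC subrK lnV ?posrE; lra.
rewrite ger0_norm; last first.
  by rewrite le_min !divr_ge0 //; lra.
rewrite ge_min; apply/orP.
(* [l] is the largest number of cells holding fewer than [n] bits. *)
have [l ln_lt n_le] : exists2 l, (l * w < n)%N & (n <= l.+1 * w)%N.
  by exists (n.-1 %/ w)%N; [have := leq_trunc_div n.-1 w|have := ltn_ceil n.-1 w0]; lia.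
have [lT|lT] := ltnP l (2 * T).
  right; rewrite ler_pdivrMr // -!natrM ler_nat; nia.
have lS : (l < S)%N by rewrite -(ltn_pmul2r w0); lia.
have [q lE] : exists q, l = (q + T)%N by exists (l - T)%N; lia.
have [d SE] : exists d, S = (q + d + T)%N by exists (S - l)%N; lia.
have := tradeoff q d (esym SE); rewrite -lE => /(_ ln_lt) tr.
have T0 : (0 < T)%N.
  case: (posnP T) tr => // ->; rewrite !expn0; nia.
have q0 : (0 < q)%N by lia.
have qR : 0 < q%:R :> R by rewrite ltr0n.
have dq0 : 0 <= d%:R / q%:R :> R by rewrite divr_ge0.
(* n <= sqrt g, so squaring the trade-off and cancelling g removes n. *)
have g_le : (g * q ^ (T * 2) <= (q + d) ^ (T * 2))%N.
  rewrite !expnM -(@leq_pmul2l g); last by lia.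
  have := leq_mul tr tr; move: (q ^ T)%N ((q + d) ^ T)%N => a b ab.
  rewrite -!mulnn; apply: (@leq_trans (n * b * (n * b))); first by nia.
  rewrite mulnACA leq_mul2r -mulnn in gn *; apply/orP; right; lia.
have lng_le : ln g%:R <= (T * 2)%:R * ln (1 + d%:R / q%:R) :> R.
  rewrite mulr_natl -lnXn; last by lra.
  rewrite ler_ln ?posrE; [|lra|by rewrite exprn_gt0 //; lra].
  have -> : 1 + d%:R / q%:R = (q + d)%:R / q%:R :> R.
    by rewrite natrD mulrDl divff // gt_eqF.
  by rewrite expr_div_n ler_pdivlMr ?exprn_gt0 // -!natrX -natrM ler_nat.
(* Since [2 * T <= l = q + T], one has [T <= q], hence [l + 1 <= 2 * q + 1 <= 3 * q]. *)
have n3q : (n <= 3 * q * w)%N.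
  by apply: leq_trans n_le _; rewrite leq_mul2r; apply/orP; right; lia.
have SwE : (S * w = l * w + d * w)%N by rewrite -mulnDl SE lE addnAC.
rewrite mulSn in n_le.
clear tradeoff tr g_le gn SE lE.
have TR : 0 < T%:R :> R by rewrite ltr0n.
(* When Sw is within one word of n, ln x may vanish, but then at most two cells are dropped and d/q
   <= 6w/n bounds n/w instead. *)
have [Sn|Sn] := leqP (S * w) (n + w).
  right.
  have : ln (1 + d%:R / q%:R) <= d%:R / q%:R :> R by apply: le_ln1Dx; lra.
  have d2 : (d <= 2)%N by rewrite -(leq_pmul2r w0); lia.
  have : d%:R / q%:R <= 6%:R / (n%:R / w%:R) :> R.
    rewrite invf_div mulrA ler_pdivrMr // mulrAC ler_pdivlMr //.
    rewrite -!natrM ler_nat (leq_trans (leq_mul d2 n3q)) //.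
    by apply/eq_leq; ring.
  have rR : 0 < n%:R / w%:R :> R by rewrite divr_gt0.
  rewrite natrM in lng_le.
  set r := n%:R / w%:R in rR *; set y := ln (1 + _) in lng_le *.
  set z := d%:R / _ => zr yz.
  have : ln g%:R <= T%:R * 2%:R * (6%:R / r) by apply: le_trans lng_le _; nra.
  by rewrite mulrA ler_pdivlMr //; nra.
left.
have x_gt1 : 1 < x by rewrite ltr_pdivlMr // mul1r -natrM ltr_nat (leq_ltn_trans _ Sn) ?leq_addr.
rewrite ler_pdivrMr ?ln_gt0 //.
have dx : d%:R / q%:R <= 6%:R * (x - 1) :> R.
  rewrite (_ : 6%:R * (x - 1) = (6 * (S * w - n))%:R / n%:R); last first.
    by rewrite natrM natrB // natrM /x; field; rewrite gt_eqF.
  rewrite ler_pdivrMr // mulrAC ler_pdivlMr // -!natrM ler_nat.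
  (* Rounding in [l] costs at most one word, which [S * w - n] now exceeds. *)
  have : (d * w <= 2 * (S * w - n))%N by lia.
  move=> dw; apply: (@leq_trans (d * (3 * q * w))); first by rewrite leq_mul2l n3q orbT.
  rewrite (_ : d * (3 * q * w) = 3 * q * (d * w))%N; last by ring.
  rewrite (_ : 6 * _ * q = 3 * q * (2 * (S * w - n)))%N; last by ring.
  by rewrite leq_mul2l dw orbT.
(* Bernoulli gives 1 + 6(x - 1) <= x^6, which keeps the bound sharp as x tends to 1. *)
have : ln (1 + d%:R / q%:R) <= 6%:R * ln x :> R.
  have -> : 6%:R * ln x = ln (x ^+ 6) by rewrite lnXn ?mulr_natl //; lra.
  rewrite ler_ln ?posrE; [|lra|by rewrite exprn_gt0 //; lra].
  have := @bernoulli_inequality R (x - 1) 6; rewrite subr_ge0 [1 + (x - 1)]addrC subrK.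
  by move=> /(_ x1); lra.
move=> /(ler_wpM2l (ltW TR)) ln_dq; apply: le_trans lng_le _.
have : 0 <= T%:R * ln x by rewrite mulr_ge0.
by rewrite natrM; lra.
Qed.

Theorem theorem4 (R : realType) (G : nat -> finZmodType) (S w : nat -> nat)
    (D : forall n : nat, cell_probe_ds (G n) (S n) (w n)) :
  (fun n : nat => n%:R ^+ 2 : R^o) =o_\oo (fun n : nat => #|G n|%:R : R^o) ->
  (fun n : nat => (w n)%:R : R^o) =Omega_\oo (fun n : nat => ln n%:R : R^o) ->
  (forall n : nat, solves_3SUM_indexing n (D n)) ->
  (forall n : nat, nonadaptive n (D n)) ->
  (fun n : nat => (query_time n (D n))%:R : R^o) =Omega_\oo
  (fun n : nat =>
     Num.min (ln (#|G n|%:R) / ln ((S n)%:R * (w n)%:R / n%:R))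
             (n%:R / (w n)%:R) : R^o).
Proof.
move=> /eqoP largeG _ solvesD nonadaptD.
rewrite eqOmegaE qualifE; apply/asboolP; exists 16%:R^-1; first by rewrite invr_gt0.
near=> n.
rewrite ler_pdivrMl // (ger0_norm (ler0n _ _)).
have n1 : (1 < n)%N by near: n; exact: nbhs_infty_gt.
have Gn : (n ^ 2 + n <= #|G n|)%N.
  (* The constant 1/2 gives [2 * n ^ 2 <= #|G n|], which absorbs the extra [n]. *)
  have : (`|n%:R ^+ 2 : R^o| <= 2^-1 * `|#|G n|%:R : R^o|).
    by near: n; apply: largeG; rewrite invr_gt0.
  rewrite !ger0_norm ?exprn_ge0 // ler_pdivlMl // -natrX -natrM ler_nat.
  nia.
have [P probesD] := nonadaptD n.
have n0 := ltnW n1.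
apply: min_le_query_time => //; first exact: memory_size_ge (solvesD n) probesD _ _.
by move=> q d; apply: query_time_tradeoff (solvesD n) probesD _ _ q d.
Unshelve. all: by end_near. Qed.
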